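(* Let $m \ge n \ge 1$ be integers. Let $D \subset \mathbb{R}^n$ be an open set whose closure $\overline{D}$ satisfies $\overline{D} \setminus D = \bigsqcup_{j\in J} S_j$ (disjoint union), where $J$ is a finite set and each $S_j$ is an $(n-1)$-dimensional smooth submanifold of $\mathbb{R}^n$ without boundary that is a union of finitely many connected components of the zero set of some smooth function $g_j:\mathbb{R}^n\to\mathbb{R}$ having no critical point on $S_j$. Let $I$ be an interval of the form $I=[a_1,a_2]$ with $a_1<a_2$ real, or $I=[a,\infty)$ with $a$ real, and let $F:\mathbb{R}^n\times I\to\mathbb{R}$ be a smooth function. For $t\in I$ put $F_t(x):=F(x,t)$. Suppose the following. (1) $\overline{D} = \{x\in\mathbb{R}^n \mid F(x,t)=0 \text{ for some } t\in I\}$. (2) For distinct $t_1,t_2\in I$, the sets $F_{t_1}^{-1}(0)$ and $F_{t_2}^{-1}(0)$ are disjoint. If $I=[a_1,a_2]$, there are subsets $J_1,J_2\subset J$ with $J=J_1\sqcup J_2$ and $F_{a_i}^{-1}(0)=\bigsqcup_{j\in J_i}S_j$ for $i=1,2$ (so that $F_{a_1}^{-1}(0)\sqcup F_{a_2}^{-1}(0)=\bigsqcup_{j\in J}S_j$), and for $i=1,2$ the function $F_{a_i}$ has no critical point on $F_{a_i}^{-1}(0)$. If $I=[a,\infty)$, then $F_a^{-1}(0)=\bigsqcup_{j\in J}S_j$ and $F_a$ has no critical point on $F_a^{-1}(0)$. (3) $\frac{\partial F}{\partial t}(x_0,t_0)\neq 0$ for every $(x_0,t_0)\in\mathbb{R}^n\times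 I$. Define $$X_{F,m}:=\Big\{(x,t,(y_j)_{j=1}^{m-n+1})\in\mathbb{R}^n\times I\times\mathbb{R}^{m-n+1} \;\Big|\; F(x,t)=0,\ G(t,(y_j)_{j=1}^{m-n+1})=0\Big\},$$ where $G(t,(y_j)):=(t-a_1)(a_2-t)-\sum_{j=1}^{m-n+1}y_j^2$ if $I=[a_1,a_2]$, and $G(t,(y_j)):=(t-a)-\sum_{j=1}^{m-n+1}y_j^2$ if $I=[a,\infty)$. Then $X_{F,m}$ is an $m$-dimensional smooth submanifold of $\mathbb{R}^{m+2}$ with no boundary.
   Context: Smooth means $C^\infty$; a function on $\mathbb{R}^n\times I$ is smooth if it extends to a smooth function on an open neighborhood of $\mathbb{R}^n\times I$ in $\mathbb{R}^{n+1}$, and $\partial/\partial t$ at boundary points of $I$ is the corresponding one-sided derivative. A critical point of a real-valued smooth function is a point where its differential vanishes. $\mathbb{R}^n\times\mathbb{R}\times\mathbb{R}^{m-n+1}$ is identified with $\mathbb{R}^{m+2}$. *)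

(* Defs.v *)
(* Written against MathComp and MathComp-Analysis; the real numbers are an
   arbitrary [R : realType]. *)
From HB Require Import structures.
From mathcomp Require Import all_boot all_order all_algebra.
From mathcomp Require Import all_classical all_reals all_analysis.

Set Implicit Arguments.
Unset Strict Implicit.
Unset Printing Implicit Defensive.

Import Order.TTheory GRing.Theory Num.Theory.
Import numFieldNormedType.Exports.

Local Open Scope classical_set_scope.
Local Open Scope ring_scope.

Section Smooth.
Context {R : realType} {V W : normedModType R}.

(* [U] is meant to be open.  Only the values of [f] on [U] matter: for [x] in
   [U], ['D_v f x] depends on the germ of [f] at [x] only.  The direction [v]
   ranges over all vectors rather than over a basis, which avoids choosing
   coordinates on [V]. *)
Fixpoint Ck (k : nat) (U : set V) (f : V -> W) : Prop :=
  if k is k'.+1 then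
    (forall x, U x -> differentiable f x) /\ (forall v : V, Ck k' U ('D_v f))
  else forall x, U x -> {for x, continuous f}.

Definition Cinfty (U : set V) (f : V -> W) : Prop := forall k, Ck k U f.

(* For a set [A] that need not be open.  The values of [f] outside [A] are
   irrelevant. *)
Definition smooth_on (A : set V) (f : V -> W) : Prop :=
  exists (U : set V) (f' : V -> W),
    [/\ open U, A `<=` U, Cinfty U f' & forall x, A x -> f x = f' x].

End Smooth.

Definition critical_point {R : realType} {V : normedModType R}
  (f : V -> R) (x : V) : Prop := forall v : V, 'd f x v = 0.

(* The coordinate subspace R^d x {0} of R^N. *)
Definition coord_subspace {R : realType} (N d : nat) : set 'rV[R]_N :=
  [set q | forall i : 'I_N, (d <= i)%N -> q ord0 i = 0].

(* Embedded [d]-dimensional submanifolds without boundary: around each point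
   there is a smooth diffeomorphism [phi] between open sets [U] and [V] of R^N,
   with inverse [psi], that straightens [M].  As usual, the empty set is a
   submanifold of every dimension [d <= N]. *)
Definition smooth_submanifold {R : realType} (N d : nat) (M : set 'rV[R]_N)
    : Prop :=
  (d <= N)%N /\
  forall p, M p ->
  exists (U V : set 'rV[R]_N) (phi psi : 'rV[R]_N -> 'rV[R]_N),
    [/\ open U, open V & U p] /\
    [/\ Cinfty U phi, phi @` U `<=` V & forall x, U x -> psi (phi x) = x] /\
    [/\ Cinfty V psi, psi @` V `<=` U & forall y, V y -> phi (psi y) = y] /\
    phi @` (M `&` U) = coord_subspace d `&` V.

Definition zero_set {R : realType} {V : Type} (f : V -> R) : set V :=
  [set x | f x = 0].

Definition is_component {T : topologicalType} (A C : set T) : Prop :=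
  exists2 x, A x & C = connected_component A x.

Definition finite_union_of_components {T : topologicalType} (A S : set T)
    : Prop :=
  exists2 Cs : set (set T),
    finite_set Cs /\ (forall C, Cs C -> is_component A C) &
    S = \bigcup_(C in Cs) C.

(* The two admissible shapes of the interval: [Segment a1 a2] stands for
   [a1, a2], and [HalfLine a] for [a, +oo). *)
Variant base_interval (R : realType) : Type :=
  | Segment of R & R
  | HalfLine of R.

Section BaseInterval.
Context {R : realType}.

Definition itv_carrier (I : base_interval R) : set R :=
  match I with
  | Segment a1 a2 => [set t | a1 <= t <= a2]
  | HalfLine a => [set t | a <= t]
  end.

Definition itv_wf (I : base_interval R) : Prop :=
  if I is Segment a1 a2 then a1 < a2 else True.

Definition fiber_eq (I : base_interval R) (k : nat) (t : R) (y : 'rV[R]_k)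
    : R :=
  match I with
  | Segment a1 a2 => (t - a1) * (a2 - t) - \sum_(j < k) y ord0 j ^+ 2
  | HalfLine a => (t - a) - \sum_(j < k) y ord0 j ^+ 2
  end.

Section Family.
Context {n : nat}.
Implicit Types (F : 'rV[R]_n * R -> R) (I : base_interval R).

Definition slice F (t : R) : 'rV[R]_n -> R := fun x => F (x, t).

(* The limit is taken within the interval, so it is the one-sided derivative at
   an endpoint and the usual derivative at an interior point. *)
Definition partial_t I F (x : 'rV[R]_n) (t : R) : R :=
  lim ((F (x, s) - F (x, t)) / (s - t)
         @[s --> within (itv_carrier I `\ t) (nbhs t)]).

Definition regular_zero_set (f : 'rV[R]_n -> R) : Prop :=
  forall x, zero_set f x -> ~ critical_point f x.

Definition endpoint_condition I F (J : finType) (S : J -> set 'rV[R]_n)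
    : Prop :=
  match I with
  | Segment a1 a2 =>
      (exists J1 J2 : set J,
        [/\ J1 `|` J2 = setT, J1 `&` J2 = set0,
            zero_set (slice F a1) = \bigcup_(j in J1) S j &
            zero_set (slice F a2) = \bigcup_(j in J2) S j]) /\
      regular_zero_set (slice F a1) /\ regular_zero_set (slice F a2)
  | HalfLine a =>
      zero_set (slice F a) = \bigcup_j S j /\ regular_zero_set (slice F a)
  end.

End Family.

Lemma dim_eq (n m : nat) : (n <= m)%N -> (n + 1 + (m - n + 1) = m + 2)%N.
Proof. by move=> nm; rewrite addnACA subnKC. Qed.

(* The identification of R^n x R x R^(m-n+1) with R^(m+2). *)
Definition join_coords (n m : nat) (nm : (n <= m)%N)
    (x : 'rV[R]_n) (t : R) (y : 'rV[R]_(m - n + 1)) : 'rV[R]_(m + 2) :=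
  castmx (erefl 1%N, dim_eq nm) (row_mx (row_mx x (\row_(_ < 1) t)) y).

Definition X_F (n m : nat) (nm : (n <= m)%N) (I : base_interval R)
    (F : 'rV[R]_n * R -> R) : set 'rV[R]_(m + 2) :=
  [set p | exists x t (y : 'rV[R]_(m - n + 1)),
     [/\ itv_carrier I t, F (x, t) = 0, fiber_eq I t y = 0 &
         p = join_coords nm x t y]].

End BaseInterval.

(* Main.v *)
Require Import Defs.
From HB Require Import structures.
From mathcomp Require Import all_boot all_order all_algebra.
From mathcomp Require Import all_classical all_reals all_analysis.
From mathcomp Require Import perm ring lra.
Set Implicit Arguments.
Unset Strict Implicit.
Unset Printing Implicit Defensive.
Import Order.TTheory GRing.Theory Num.Theory.
Import numFieldNormedType.Exports.
Local Open Scope classical_set_scope.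
Local Open Scope ring_scope.

(** Near a point [p], the set [X_F] is the common zero set of two smooth
    functions on R^(m+2): [F] extended to an open set and read off the
    coordinates [(x, t)], and the fiber function [G] of [(t, y)].  The condition
    that [t] lies in the interval comes for free, since [G = 0] forces
    [(t - a1) (a2 - t)], or [t - a], to be a sum of squares.

    The two differentials are independent, and this is visible on a pair of
    coordinates on which the Jacobian is triangular:
    - if some [y_j <> 0], then [dG/dy_j = - 2 y_j <> 0] and [dF/dt <> 0], while
      [F] does not depend on [y_j];
    - if [y = 0], then [t] is an endpoint of the interval, so [dG/dt <> 0], and
      the regularity of the endpoint slice gives [dF/dx_i <> 0] for some [i],
      while [G] does not depend on [x_i].

    The triangular shape lets the straightening chart be built one coordinate
    at a time, so that the inverse function theorem is needed only for maps that
    replace a single coordinate [x_i] by a function [f] with [df/dx_i > 0]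
    ([smooth_diffeo_set_coord]).  For such a map everything takes place on lines
    parallel to the axis: within a small ball, [f] is strictly increasing on
    each of them, which gives injectivity, and the intermediate value theorem
    gives openness ([shear_inj], [shear_open]).  The inverse is differentiable
    ([is_diff_local_inverse]), and its derivatives are rational expressions in
    the derivatives of [f] at the inverse itself, so that its smoothness follows
    by induction on the order from the closure of [Ck] under the usual
    operations.  Composing two such maps with a permutation of the coordinates
    proves [submanifold_two_equations], a regular value theorem in
    codimension 2. *)

(** * First-order approximation *)

Section FirstOrder.
Context {R : realType} {V W : normedModType R}.
Implicit Types (f g : V -> W) (x : V).

(** With explicit epsilons instead of a little-o, the estimate can be pulled
    back along a limit: of an inverse map in [is_diff_local_inverse], of points
    of the interval in [partial_tE]. *)
Lemma eqaddo_id_remainder f (L : V -> W) x :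
  (f \o shift x = cst (f x) + L +o_ 0 id) <->
  (forall e : R, 0 < e -> \forall y \near x,
    `|f y - f x - L (y - x)| <= e * `|y - x|).
Proof.
split=> [/eqaddoP fL e /fL|fL]; last apply/eqaddoP => e /fL.
  rewrite (near_shift 0 x); apply: filterS => y /=.
  by rewrite subr0 addrK opprD addrA.
rewrite (near_shift 0 x); apply: filterS => y /=.
rewrite subr0 addrK -[X in _ -> `|X| <= _]/(f (y + x) - (f x + L y)).
by rewrite opprD addrA.
Qed.

Lemma is_diff_remainder f (L : V -> W) x : linear L -> continuous L ->
  (forall e : R, 0 < e -> \forall y \near x,
    `|f y - f x - L (y - x)| <= e * `|y - x|) ->
  is_diff x f L.
Proof.
move=> Llin Lcont /eqaddo_id_remainder fL.
pose LM := GRing.isLinear.Build _ _ _ _ _ Llin.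
pose Lp : {linear V -> W} := HB.pack L LM.
have dE : 'd f x = Lp :> (V -> W) by apply: diff_unique.
by apply: DiffDef => //; apply/diff_locallyP; rewrite dE.
Qed.

Lemma diff_remainder f x : differentiable f x ->
  forall e : R, 0 < e -> \forall y \near x,
    `|f y - f x - 'd f x (y - x)| <= e * `|y - x|.
Proof. by move=> /diff_locally/eqaddo_id_remainder. Qed.

Lemma near_eq_differentiable f g x :
  (\near x, f x = g x) -> differentiable f x -> differentiable g x.
Proof.
move=> fg df; suff [] : is_diff x g ('d f x) by [].
apply: is_diff_remainder; [exact: linearP|exact: diff_continuous|].
move=> e e0; rewrite -(nbhs_singleton fg).
by apply: filterS2 fg (diff_remainder df e0) => y <-.
Qed.

End FirstOrder.

(** * Calculus of C^k maps *)

Section CkBasics.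
Context {R : realType} {V W : normedModType R}.
Implicit Types (k : nat) (U : set V) (f g : V -> W).

Lemma Ck_ext k U f g : open U -> (forall x, U x -> f x = g x) ->
  Ck k U f -> Ck k U g.
Proof.
move=> oU; elim: k f g => [|k IHk] f g fg.
  move=> cf x Ux; rewrite /prop_for /continuous_at -fg//.
  apply: cvg_trans (cf x Ux); apply: near_eq_cvg.
  by apply: filterS (open_nbhs_nbhs (conj oU Ux)) => y /fg.
have near_fg x : U x -> \near x, f x = g x.
  by move=> Ux; apply: filterS (open_nbhs_nbhs (conj oU Ux)) => y /fg.
move=> [df Df]; split=> [x Ux|v].
  exact: near_eq_differentiable (near_fg _ Ux) (df _ Ux).
by apply: IHk (Df v) => x /near_fg; exact: near_eq_derive.
Qed.

Lemma Ck_subset k U U' f : U' `<=` U -> Ck k U f -> Ck k U' f.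
Proof.
move=> sU; elim: k f => [|k IHk] f; first by move=> cf x /sU /cf.
by move=> [df Df]; split=> [x /sU /df //|v]; exact: IHk (Df v).
Qed.

Lemma Ck_continuous k U f : Ck k U f -> forall x, U x -> {for x, continuous f}.
Proof. by case: k => // k [df _] x /df /differentiable_continuous. Qed.

Lemma Ck_pred k U f : Ck k.+1 U f -> Ck k U f.
Proof.
elim: k f => [|k IHk] f Cf; first exact: Ck_continuous Cf.
by case: Cf => df Df; split=> // v; exact: IHk (Df v).
Qed.

Lemma Ck_cst k U (a : W) : Ck k U (cst a).
Proof.
elim: k a => [|k IHk] a; first by move=> x _; exact: cst_continuous.
split=> [x _|v]; first exact: differentiable_cst.
have -> : 'D_v (cst a) = cst 0 by apply/funext => x; rewrite derive_cst.
exact: IHk.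
Qed.

Lemma Ck_linear k U (L : {linear V -> W}) : continuous L -> Ck k U L.
Proof.
move=> Lc; case: k => [|k]; first by move=> x _; exact: Lc.
split=> [x _|v]; first exact: linear_differentiable.
have -> : 'D_v L = cst (L v).
  apply/funext => x; rewrite deriveE; last exact: linear_differentiable.
  by rewrite diff_lin.
exact: Ck_cst.
Qed.

Lemma CkD k U f g : open U -> Ck k U f -> Ck k U g -> Ck k U (f + g).
Proof.
move=> oU; elim: k f g => [|k IHk] f g.
  by move=> cf cg x Ux; apply: continuousD; [exact: cf|exact: cg].
move=> [df Df] [dg Dg]; split=> [x Ux|v].
  by apply: differentiableD; [exact: df|exact: dg].
apply: Ck_ext (IHk _ _ (Df v) (Dg v)) => // x Ux; rewrite deriveD//.
  exact/diff_derivable/df.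
exact/diff_derivable/dg.
Qed.

Lemma Ck_sum k U (r : nat) (h : 'I_r -> V -> W) : open U ->
  (forall i, Ck k U (h i)) -> Ck k U (fun x => \sum_i h i x).
Proof.
move=> oU; elim: r h => [|r IHr] h Ch.
  by apply: Ck_ext (Ck_cst k U 0) => // x _; rewrite big_ord0.
apply: Ck_ext (CkD oU (IHr (fun i => h (widen_ord (leqnSn r) i)) _)
                      (Ch ord_max)) => // x _.
by rewrite big_ord_recr.
Qed.

End CkBasics.

Section CkLinear.
Context {R : realType} {V W Z : normedModType R}.

Lemma Ck_linear_comp k (U : set V) (f : V -> W) (L : {linear W -> Z}) :
  open U -> continuous L -> Ck k U f -> Ck k U (L \o f).
Proof.
move=> oU Lc; elim: k f => [|k IHk] f.
  by move=> cf x Ux; apply: continuous_comp; [exact: cf|exact: Lc].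
move=> [df Df]; split=> [x Ux|v].
  by apply: differentiable_comp; [exact: df|exact: linear_differentiable].
have Ld y : differentiable L y by exact: linear_differentiable.
apply: Ck_ext (IHk _ (Df v)) => // x Ux; have dfx := df _ Ux.
rewrite /= !deriveE//; last exact: differentiable_comp.
by rewrite (diff_comp dfx (Ld _)) /= diff_lin.
Qed.

Lemma derive_comp_linear (f : W -> Z) (L : {linear V -> W}) x v :
  'D_v (f \o L) x = 'D_(L v) f (L x).
Proof. by rewrite /derive /=; under eq_fun do rewrite linearP. Qed.

Lemma Ck_comp_linear k (U : set W) (f : W -> Z) (L : {linear V -> W}) :
  continuous L -> Ck k U f -> Ck k (L @^-1` U) (f \o L).
Proof.
move=> Lc; elim: k f => [|k IHk] f.
  by move=> cf x Ux; apply: continuous_comp; [exact: Lc|exact: cf].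
move=> [df Df]; split=> [x Ux|v].
  by apply: differentiable_comp; [exact: linear_differentiable|exact: df].
have -> : 'D_v (f \o L) = 'D_(L v) f \o L.
  by apply/funext => x; exact: derive_comp_linear.
exact: IHk (Df _).
Qed.

End CkLinear.

Section CkScalar.
Context {R : realType} {V : normedModType R}.
Implicit Types (k : nat) (U : set V) (f g : V -> R).

(** The Leibniz rule expresses the derivative through [f] and [g] themselves,
    which is why the induction needs [Ck_pred]; the same holds for [CkV]. *)
Lemma CkM k U f g : open U -> Ck k U f -> Ck k U g -> Ck k U (f * g).
Proof.
move=> oU; elim: k f g => [|k IHk] f g.
  by move=> cf cg x Ux; apply: continuousM; [exact: cf|exact: cg].
move=> Cf Cg; have [[df Df] [dg Dg]] := (Cf, Cg); split=> [x Ux|v].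
  by apply: differentiableM; [exact: df|exact: dg].
apply: Ck_ext (CkD oU (IHk _ _ (Ck_pred Cf) (Dg v))
                      (IHk _ _ (Ck_pred Cg) (Df v))) => // x Ux.
by rewrite deriveM//; apply: diff_derivable; [exact: df|exact: dg].
Qed.

Lemma CkV k U f : open U -> (forall x, U x -> f x != 0) -> Ck k U f ->
  Ck k U (fun x => (f x)^-1).
Proof.
move=> oU f0; elim: k => [|k IHk].
  by move=> cf x Ux; apply: continuousV; [exact: f0|exact: cf].
move=> Cf; have [df Df] := Cf; split=> [x Ux|v].
  by apply: differentiableV; [exact: df|exact: f0].
have CV := IHk (Ck_pred Cf).
have CD := CkM oU (CkM oU (Ck_cst k U (-1 : R)) (CkM oU CV CV)) (Df v).
apply: Ck_ext oU _ CD => x Ux.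
rewrite deriveV//; [|exact: f0|exact/diff_derivable/df].
by rewrite -[LHS]/(-1 * ((f x)^-1 * (f x)^-1) * 'D_v f x) mulN1r -invfM -expr2.
Qed.

End CkScalar.

Section CkComp.
Context {R : realType} {V : normedModType R} {N : nat}.

(** The coordinate of a row vector as a named function, so that it can carry a
    linear structure. *)
Definition rcoord (i : 'I_N) (x : 'rV[R]_N) : R := x ord0 i.

Lemma rcoord_is_linear i : linear (rcoord i).
Proof. by move=> a x y; rewrite /rcoord !mxE. Qed.
HB.instance Definition _ i :=
  GRing.isLinear.Build R 'rV[R]_N R *:%R (rcoord i) (rcoord_is_linear i).

Lemma rcoord_continuous i : continuous (rcoord i).
Proof. exact: coord_continuous. Qed.

(** In the chain rule the direction ['D_v f x] moves with [x], whereas [Ck] only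
    controls derivatives in a fixed direction.  Expanding that direction in the
    standard basis turns ['D_v (g \o f)] into a sum of products of functions to
    which the induction hypothesis applies. *)
Lemma Ck_comp_scalar k (U : set V) (U' : set 'rV[R]_N) (f : V -> 'rV[R]_N)
    (g : 'rV[R]_N -> R) : open U -> f @` U `<=` U' ->
  Ck k U f -> Ck k U' g -> Ck k U (g \o f).
Proof.
move=> oU fU; have fU' x : U x -> U' (f x) by move=> Ux; apply: fU; exists x.
elim: k f g fU fU' => [|k IHk] f g fU fU'.
  by move=> cf cg x Ux; apply: continuous_comp; [exact: cf|exact/cg/fU'].
move=> Cf Cg; have [[df Df] [dg Dg]] := (Cf, Cg); split=> [x Ux|v].
  by apply: differentiable_comp; [exact: df|exact/dg/fU'].
apply: (@Ck_ext _ _ _ _ _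
  (fun x => \sum_i (rcoord i \o 'D_v f) x * ('D_('e_i) g \o f) x)) => //.
  move=> x Ux; have dfx := df _ Ux; have dgx := dg _ (fU' _ Ux).
  rewrite [RHS]deriveE; last exact: differentiable_comp.
  rewrite (diff_comp dfx dgx) /= -(deriveE _ dfx).
  rewrite [in RHS](row_sum_delta ('D_v f x)) linear_sum.
  by apply: eq_bigr => i _; rewrite linearZ -deriveE.
apply: Ck_sum => // i; apply: CkM => //.
  exact: Ck_linear_comp oU (@rcoord_continuous i) (Df v).
by apply: IHk (Dg _) => //; exact: Ck_pred.
Qed.

Lemma Ck_scale_cst {W : normedModType R} k (U : set V) (f : V -> R) (w : W) :
  open U -> Ck k U f -> Ck k U (fun x => f x *: w).
Proof.
move=> oU Cf.
have slin : linear ( *:%R ^~ w : R -> W).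
  by move=> a y z; rewrite scalerDl scalerA.
pose sM := GRing.isLinear.Build _ _ _ _ _ slin.
pose s : {linear R -> W} := HB.pack ( *:%R ^~ w : R -> W) sM.
by apply: (@Ck_linear_comp _ _ _ _ k U f s) => //; exact: scalel_continuous.
Qed.

Lemma Ck_rcoordP k (U : set V) (f : V -> 'rV[R]_N) : open U ->
  (forall i, Ck k U (rcoord i \o f)) -> Ck k U f.
Proof.
move=> oU Cf.
apply: (@Ck_ext _ _ _ _ _ (fun x => \sum_i (rcoord i \o f) x *: 'e_i)) => //.
  by move=> x _; rewrite [RHS]row_sum_delta.
by apply: Ck_sum => // i; exact: Ck_scale_cst.
Qed.

End CkComp.

Lemma Ck_comp {R : realType} {V : normedModType R} {N M : nat} k (U : set V)
    (U' : set 'rV[R]_N) (f : V -> 'rV[R]_N) (g : 'rV[R]_N -> 'rV[R]_M) :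
  open U -> open U' -> f @` U `<=` U' ->
  Ck k U f -> Ck k U' g -> Ck k U (g \o f).
Proof.
move=> oU oU' fU Cf Cg; apply: Ck_rcoordP => // i.
apply: (@Ck_comp_scalar _ _ _ _ _ U' f (rcoord i \o g)) => //.
by apply: Ck_linear_comp => //; exact: rcoord_continuous.
Qed.
(** * Inverting a map that moves points along one direction *)

Section LocalInverse.
Context {R : realType} {V W : normedModType R}.

(** With [u := g y - g z] one has [y - z = A u + o(u)], hence
    [B (y - z) = u + o(u)].  Taking the error at most [u / 2] first bounds [u]
    by a multiple of [y - z]; the error [o(u)] is then also [o(y - z)]. *)
Lemma is_diff_local_inverse (f : V -> W) (g : W -> V) (A : V -> W)
    (B : W -> V) (z : W) :
  is_diff (g z) f A -> linear B -> continuous B -> cancel A B ->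
  {for z, continuous g} -> (\near z, f (g z) = z) ->
  is_diff z g B.
Proof.
move=> [df dfE] Blin Bcont AB gcont fg.
apply: is_diff_remainder => // e e0.
pose BM := GRing.isLinear.Build _ _ _ _ _ Blin.
pose Bp : {linear W -> V} := HB.pack B BM.
have [k k0 Bk] := @linear_lipschitz _ _ _ Bp Bcont.
have fgz : f (g z) = z := nbhs_singleton fg.
have main d : 0 < d -> \forall y \near z,
    `|g y - g z - B (y - z)| <= k * d * `|g y - g z|.
  move=> d0; have := gcont _ (diff_remainder df d0).
  rewrite dfE; apply: filterS2 fg => y /= fgy; rewrite fgy fgz => rem.
  rewrite -{1}(AB (g y - g z)) -[X in `|X|](raddfB Bp) /=.
  rewrite (le_trans (Bk _))// -mulrA ler_pM2l// distrC//.
(* the remainder is at most half of [u] *)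
have := main (2 * k)^-1; rewrite invr_gt0 pmulr_rgt0// => /(_ k0) half.
(* [u] is at most [2 k] times [y - z], hence this constant *)
have := main (e / (2 * k ^+ 2)).
rewrite divr_gt0 ?pmulr_rgt0 ?exprn_gt0// => /(_ isT).
apply: filterS2 half => y; set u := g y - g z; set b := B (y - z) => half eps.
have kd : k * (2 * k)^-1 = 2^-1 by rewrite invfM mulrCA divff ?mulr1// gt_eqF.
have ub : `|u| <= 2 * k * `|y - z|.
  have : `|u| <= 2^-1 * `|u| + k * `|y - z|.
    rewrite -{1}(subrK b u) (le_trans (ler_normD _ _))// lerD//.
      by rewrite -kd.
    exact: Bk.
  by lra.
rewrite (le_trans eps)//.
have -> : k * (e / (2 * k ^+ 2)) = e / (2 * k).
  by field; rewrite gt_eqF.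
rewrite -ler_pdivlMl ?divr_gt0 ?pmulr_rgt0//.
rewrite invf_div (le_trans ub)// mulrA divfK//.
by rewrite gt_eqF.
Qed.

End LocalInverse.

Section Shear.
Context {R : realType} {V : normedModType R}.
Variables (e : V) (l : {linear V -> R}) (f : V -> R).
Hypotheses (l_e : l e = 1) (lcont : continuous l).

(** For [e] a basis vector and [l] the corresponding coordinate, this replaces
    that coordinate by [f]; in general [shearE] holds. *)
Definition shear (x : V) : V := x + (f x - l x) *: e.

Lemma functional_shift x (a : R) : l (x + a *: e) = l x + a.
Proof.
by rewrite linearD linearZ l_e -[X in _ + X]/(a * 1) mulr1.
Qed.

Lemma shearE x : l (shear x) = f x.
Proof. by rewrite functional_shift addrC subrK. Qed.

Lemma is_diff_shear x : differentiable f x ->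
  is_diff x shear (fun v => v + ('d f x v - l v) *: e).
Proof.
move=> dfx.
have dl : is_diff x l l.
  by apply: DiffDef; [exact: linear_differentiable|rewrite diff_lin].
have dfl := is_diffB (differentiableP dfx) dl.
have dfle := is_diff_comp dfl (is_diff_scalel (f x - l x) e).
by have [dphi dphiE] := is_diffD (is_diff_id x) dfle; exact: DiffDef.
Qed.

(** The differential [v + ('d f v - l v) e] of the shear is again a shear; it is
    inverted by solving for the component along [e], on which ['d f] acts as
    multiplication by ['d f e]. *)
Lemma is_diff_shear_inverse (psi : V -> V) z :
  differentiable f (psi z) -> 'd f (psi z) e != 0 ->
  {for z, continuous psi} -> (\near z, shear (psi z) = z) ->
  is_diff z psi
    (fun v => v + ((l v - 'd f (psi z) v) / 'd f (psi z) e) *: e).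
Proof.
set x := psi z => dfx dfe0 psic psiK.
have lZ a u : l (a *: u) = a * l u by rewrite linearZ.
have dZ a u : 'd f x (a *: u) = a * 'd f x u by rewrite linearZ.
apply: (is_diff_local_inverse (is_diff_shear dfx)) => //.
- move=> a u v; rewrite scalerDr addrACA scalerA -scalerDl; congr (_ + _ *: _).
  by rewrite (linearD l) (linearD ('d f x)) lZ dZ; ring.
- move=> v; apply: cvgD; first exact: cvg_id.
  apply: (@continuous_comp _ _ _ (fun v => (l v - 'd f x v) / 'd f x e)
    ( *:%R^~ e)); last exact: scalel_continuous.
  apply: cvgM; last exact: cvg_cst.
  by apply: cvgB; [exact: lcont|exact: diff_continuous].
- move=> v; rewrite functional_shift linearD dZ -addrA -scalerDl -[RHS]addr0.
  rewrite -[X in _ = _ + X](scale0r e); congr (_ + _ *: _).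
  by field.
Qed.

Lemma is_derive_line (x : V) (h : R) : differentiable f (h *: e + x) ->
  is_derive h 1 (fun s : R => f (s *: e + x)) ('D_e f (h *: e + x)).
Proof.
move=> df.
have dl : is_diff h (fun s : R => s *: e + x) ( *:%R^~ e).
  have -> : (fun s : R => s *: e + x) = ( *:%R^~ e : R -> V) + cst x by [].
  by apply: is_diff_eq; rewrite addr0.
apply: DeriveDef.
  by apply: diff_derivable; exact: differentiable_comp.
rewrite deriveE; last exact: differentiable_comp.
rewrite (diff_comp (@ex_diff _ _ _ _ _ _ _ dl) df) /= diff_val scale1r.
by rewrite deriveE.
Qed.

Variables (p : V) (r : R).
Hypotheses (df : forall x, ball p r x -> differentiable f x)
  (df0 : forall x, ball p r x -> 0 < 'D_e f x).

Lemma ball_line x (s h : R) : ball p r x -> ball p r (s *: e + x) ->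
  0 <= h <= s -> ball p r (h *: e + x).
Proof.
rewrite -ball_normE /= => bx bs /andP[h0 hs].
have [s0|s0] := eqVneq s 0.
  have -> : h = 0 by apply: le_anti; rewrite h0 -{1}s0 hs.
  by rewrite scale0r add0r.
have sgt0 : 0 < s by rewrite lt_neqAle eq_sym s0 (le_trans h0 hs).
have -> : p - (h *: e + x) =
    (1 - h / s) *: (p - x) + (h / s) *: (p - (s *: e + x)).
  have pE t : p - (t *: e + x) = (p - x) - t *: e.
    by rewrite opprD addrCA addrC.
  rewrite !pE [_ *: (p - x - _)]scalerBr addrA -scalerDl subrK scale1r.
  by rewrite scalerA divfK.
have hs1 : h / s <= 1 by rewrite ler_pdivrMr// mul1r.
have hs0 : 0 <= h / s by rewrite divr_ge0// ltW.
move: (h / s) hs1 hs0 => a a1 a0.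
rewrite (le_lt_trans (ler_normD _ _))// !normrZ (ger0_norm a0).
rewrite ger0_norm ?subr_ge0//.
have [->|a_neq0] := eqVneq a 0; first by rewrite subr0 mul1r mul0r addr0.
have {a_neq0} a_gt0 : 0 < a by rewrite lt_neqAle eq_sym a_neq0 a0.
by nra.
Qed.

Lemma lt_line x s : ball p r x -> ball p r (s *: e + x) -> 0 < s ->
  f x < f (s *: e + x).
Proof.
move=> bx bs s0.
pose g (h : R) := f (h *: e + x).
have bh h : 0 <= h <= s -> ball p r (h *: e + x) by exact: ball_line.
have gd h : 0 <= h <= s -> is_derive h 1 g ('D_e f (h *: e + x)).
  by move=> /bh /df; exact: is_derive_line.
have [||h] := @MVT _ g (fun h => 'D_e f (h *: e + x)) 0 s s0.
- move=> h; rewrite in_itv /= => /andP[h0 hs]; apply: gd.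
  by rewrite !ltW.
- apply: derivable_within_continuous => h; rewrite in_itv /= => /gd.
  by case.
- rewrite in_itv /= subr0 => /andP[h0 hs] gE.
  suff : 0 < g s - g 0 by rewrite /g scale0r add0r subr_gt0.
  by rewrite gE mulr_gt0//; apply/df0/bh; rewrite !ltW.
Qed.

(** Two points with the same image lie on a line directed by [e] and have the
    same value under [f]. *)
Lemma shear_inj x y : ball p r x -> ball p r y -> shear x = shear y -> x = y.
Proof.
wlog xy : x y / l x - f x <= l y - f y.
  move=> H bx by' s; have [|/ltW] := leP (l x - f x) (l y - f y).
    by move/H; exact.
  by move=> /H h; apply/esym/h.
move=> bx by' s; have fxy : f x = f y by rewrite -!shearE s.
have yE : y = (l y - l x) *: e + x.
  move: s; rewrite /shear fxy => /(congr1 (fun v => v - (f y - l y) *: e)).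
  rewrite addrK -addrA -scalerBl => s; rewrite -[LHS]s addrC.
  congr (_ *: _ + _).
  by ring.
have [s0|s0|s0] := ltgtP 0 (l y - l x).
- by have := @lt_line x _ bx _ s0; rewrite -yE fxy ltxx => /(_ by').
- by move: s0; rewrite subr_lt0 ltNge; move: xy; rewrite fxy lerD2r => ->.
- by rewrite yE -s0 scale0r add0r.
Qed.

(** The preimage of [z] is found on the line through [z] directed by [e], by the
    intermediate value theorem: [f] takes values on both sides of [l z] there,
    because it does so on the nearby line through [x].  Since the preimage lies
    within [d] of [x], this also yields the continuity of the inverse. *)
Lemma shear_open x (d : R) : ball p r x -> 0 < d -> \forall z \near shear x,
  exists y, [/\ ball p r y, ball x d y & shear y = z].
Proof.
move=> bx d0.
have [d' d'0 sd'] : exists2 d', 0 < d' & forall y, ball x d' y ->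
    ball p r y /\ ball x d y.
  have : nbhs x (ball p r `&` ball x d).
    apply: filterI; last exact: nbhsx_ballx.
    by apply: open_nbhs_nbhs; split=> //; exact: ball_open.
  by move=> /nbhs_ballP[d' d'0 sd']; exists d'.
pose s := d' / 2 / (1 + `|e|).
have s0 : 0 < s by rewrite !divr_gt0// ltr_pwDl.
have se t : `|t| <= s -> `|t *: e| <= d' / 2.
  move=> ts; rewrite normrZ.
  have : `|t| * (1 + `|e|) <= d' / 2.
    by rewrite -ler_pdivlMr ?ltr_pwDl.
  by have := normr_ge0 t; have := normr_ge0 e; nra.
(* [base z] is the point of the line through [z] with the same [l] as [x] *)
pose base (z : V) := z - (l z - l x) *: e.
have basex : base (shear x) = x.
  by rewrite /base shearE /shear addrK.
have basec : continuous base.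
  move=> z; apply: cvgB; first exact: cvg_id.
  apply: (@continuous_comp _ _ _ (fun z => l z - l x) ( *:%R^~ e)).
    by apply: cvgB; [exact: lcont|exact: cvg_cst].
  exact: scalel_continuous.
have fline t : `|t| <= s ->
    {for shear x, continuous (fun z => f (t *: e + base z) - l z)}.
  move=> ts; apply: cvgB; last exact: lcont.
  apply: (@continuous_comp _ _ _ (fun z => t *: e + base z) f).
    by apply: cvgD; [exact: cvg_cst|exact: basec].
  rewrite basex; apply: differentiable_continuous; apply: df.
  apply: (sd' _ _).1; rewrite -ball_normE /= opprD addrCA subrr addr0 normrN.
  by rewrite (le_lt_trans (se _ ts))// ltr_pdivrMr// ltr_pMr// ltr1n.
have near_lo : \forall z \near shear x, f (- s *: e + base z) - l z < 0.
  apply: (cvgr_lt (f (- s *: e + base (shear x)) - l (shear x))).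
    by apply: fline; rewrite normrN gtr0_norm.
  rewrite basex shearE subr_lt0.
  have bs : ball p r (- s *: e + x).
    apply: (sd' _ _).1; rewrite -ball_normE /= opprD addrCA subrr addr0 normrN.
    rewrite (le_lt_trans (se _ _))// ?normrN ?gtr0_norm//.
    by rewrite ltr_pdivrMr// ltr_pMr// ltr1n.
  have := @lt_line _ s bs; rewrite addrA -scalerDl subrr scale0r add0r.
  exact.
have near_hi : \forall z \near shear x, 0 < f (s *: e + base z) - l z.
  apply: (cvgr_gt (f (s *: e + base (shear x)) - l (shear x))).
    by apply: fline; rewrite gtr0_norm.
  rewrite basex shearE subr_gt0; apply: lt_line => //.
  apply: (sd' _ _).1; rewrite -ball_normE /= opprD addrCA subrr addr0 normrN.
  rewrite (le_lt_trans (se _ _))// ?gtr0_norm//.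
  by rewrite ltr_pdivrMr// ltr_pMr// ltr1n.
have near_base : \forall z \near shear x, ball x (d' / 2) (base z).
  have := basec (shear x); rewrite /continuous_at basex; apply.
  by apply: nbhsx_ballx; rewrite divr_gt0.
near=> z.
have lo : f (- s *: e + base z) < l z by rewrite -subr_lt0; near: z.
have hi : l z < f (s *: e + base z) by rewrite -subr_gt0; near: z.
have bz : ball x (d' / 2) (base z) by near: z.
have bt t : `|t| <= s -> ball x d' (t *: e + base z).
  move=> ts; rewrite -ball_normE /= [t *: e + _]addrC opprD addrA [d']splitr.
  rewrite (le_lt_trans (ler_normB _ _))// ltr_leD ?se//.
  by move: bz; rewrite -ball_normE.
have ss : - s <= s by lra.
have [||t] := @IVT _ (fun t => f (t *: e + base z)) (- s) s (l z) ss.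
- apply: derivable_within_continuous => t; rewrite in_itv /= => ts.
  apply: (@ex_derive _ _ _ _ _ _ ('D_e f (t *: e + base z))).
  apply: is_derive_line; apply: df; apply: (sd' _ _).1; apply: bt.
  by rewrite ler_norml.
- by rewrite ge_min le_max (ltW lo) (ltW hi) orbT.
- rewrite in_itv /= -ler_norml => ts ft.
  exists (t *: e + base z); have [bp bxd] := sd' _ (bt _ ts); split=> //.
  rewrite /shear ft [t *: e + _]addrC functional_shift.
  rewrite /base -scaleNr functional_shift.
  rewrite -!addrA -!scalerDl -[RHS]addr0 -(scale0r e).
  by congr (_ + _ *: _); ring.
Unshelve. all: by end_near. Qed.

End Shear.
(** * Local diffeomorphisms of R^N *)

Section Diffeo.
Context {R : realType} {N : nat}.
Implicit Types (U V : set 'rV[R]_N) (phi psi : 'rV[R]_N -> 'rV[R]_N).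

Definition smooth_diffeo U V phi psi : Prop :=
  [/\ open U, open V,
    [/\ Cinfty U phi, phi @` U `<=` V & forall x, U x -> psi (phi x) = x] &
    [/\ Cinfty V psi, psi @` V `<=` U & forall y, V y -> phi (psi y) = y]].

Lemma open_setI_preimage U (V : set 'rV[R]_N) phi :
  open U -> open V -> Cinfty U phi -> open (U `&` phi @^-1` V).
Proof.
move=> oU oV Cphi; move: V oV; apply/(continuous_inP _ oU) => x /set_mem Ux.
exact: (Cphi 0%N x Ux).
Qed.

Lemma smooth_diffeo_comp U1 V1 phi1 psi1 U2 V2 phi2 psi2 :
  smooth_diffeo U1 V1 phi1 psi1 -> smooth_diffeo U2 V2 phi2 psi2 ->
  smooth_diffeo (U1 `&` phi1 @^-1` U2) (V2 `&` psi2 @^-1` V1)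
    (phi2 \o phi1) (psi1 \o psi2).
Proof.
move=> [oU1 oV1 [C1 i1 K1] [C1' i1' K1']] [oU2 oV2 [C2 i2 K2] [C2' i2' K2']].
have oU := open_setI_preimage oU1 oU2 C1.
have oV := open_setI_preimage oV2 oV1 C2'.
split=> //; split.
- move=> k; apply: (Ck_comp oU oU2 _ _ (C2 k)); first by move=> _ [x [_ ?] <-].
  exact: Ck_subset (C1 k).
- move=> _ [x [Ux Ux'] <-] /=; split; first by apply: i2; exists (phi1 x).
  by rewrite /= K2//; apply: i1; exists x.
- by move=> x [Ux Ux'] /=; rewrite K2// K1.
- move=> k; apply: (Ck_comp oV oV1 _ _ (C1' k)); first by move=> _ [x [_ ?] <-].
  exact: Ck_subset (C2' k).
- move=> _ [x [Ux Ux'] <-] /=; split; first by apply: i1'; exists (psi2 x).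
  by rewrite /= K1'//; apply: i2'; exists x.
- by move=> x [Ux Ux'] /=; rewrite K1'// K2'.
Qed.

Lemma smooth_diffeo_col_perm (s : 'S_N) :
  smooth_diffeo setT setT (col_perm s) (col_perm s^-1%g).
Proof.
have Cs (t : 'S_N) : Cinfty setT (col_perm t : 'rV[R]_N -> 'rV[R]_N).
  move=> k; apply: Ck_rcoordP => [|i]; first exact: openT.
  have -> : rcoord i \o col_perm t = @rcoord R _ (t i).
    by apply/funext => x; rewrite /= /rcoord mxE.
  by apply: Ck_linear; exact: rcoord_continuous.
split; [exact: openT|exact: openT|split=> // x _|split=> // x _].
  by rewrite -col_permM mulVg col_perm1.
by rewrite -col_permM mulgV col_perm1.
Qed.

Lemma rcoordE (i j : 'I_N) (x : 'rV[R]_N) (a : R) :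
  rcoord i (x + a *: 'e_j) = rcoord i x + a * (i == j)%:R.
Proof. by rewrite /rcoord !mxE eqxx. Qed.

Definition set_coord (i : 'I_N) (f : 'rV[R]_N -> R) : 'rV[R]_N -> 'rV[R]_N :=
  shear 'e_i (rcoord i) f.

Lemma rcoord_set_coord i j f x :
  rcoord j (set_coord i f x) = if j == i then f x else rcoord j x.
Proof.
rewrite /set_coord /shear rcoordE; case: eqVneq => [->|_].
  by rewrite mulr1 addrC subrK.
by rewrite mulr0 addr0.
Qed.

(** The inverse function theorem for a change of one coordinate.  The inverse
    [psi] satisfies
    ['D_v psi = v + ((v_i - 'D_v f) / 'D_('e_i) f) 'e_i], with the right-hand
    side evaluated at [psi], so [psi] being [C^k] makes it [C^(k+1)].
    The sign of the derivative is harmless since [f] can be rescaled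
    ([normalize_derive]). *)
Lemma smooth_diffeo_set_coord (i : 'I_N) (f : 'rV[R]_N -> R) U p :
  open U -> U p -> Cinfty U f -> 0 < 'D_('e_i) f p ->
  exists U0 V0 psi,
    [/\ smooth_diffeo U0 V0 (set_coord i f) psi, U0 p & U0 `<=` U].
Proof.
move=> oU Up Cf dfp0.
have [df Df] := Cf 1%N.
have [r r0 rP] : exists2 r, 0 < r & forall x, ball p r x ->
    U x /\ 0 < 'D_('e_i) f x.
  have : nbhs p (U `&` [set x | 0 < 'D_('e_i) f x]).
    apply: filterI; first exact: open_nbhs_nbhs.
    by have /cvgr_gt/(_ _ dfp0) := Df 'e_i p Up.
  by move=> /nbhs_ballP[r r0 rP]; exists r.
pose phi := set_coord i f; pose l := @rcoord R N i.
have l_e : l 'e_i = 1 by rewrite /l /rcoord mxE !eqxx.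
have lc : continuous l := @rcoord_continuous R N i.
have bU x : ball p r x -> U x by move=> /rP[].
have bdf x : ball p r x -> differentiable f x by move=> /bU; exact: df.
have bdf0 x : ball p r x -> 0 < 'D_('e_i) f x by move=> /rP[].
have phi_inj := @shear_inj _ _ 'e_i l f l_e p r bdf bdf0.
have phi_open := @shear_open _ _ 'e_i l f l_e lc p r bdf bdf0.
pose B := ball p r; pose V0 := phi @` B.
pose psi z := get (fun x => B x /\ phi x = z).
have psiP z : V0 z -> B (psi z) /\ phi (psi z) = z.
  move=> [x Bx <-]; apply: (getPex (P := fun y => B y /\ phi y = phi x)).
  by exists x.
have psiK x : B x -> psi (phi x) = x.
  by move=> Bx; have [|By /phi_inj] := psiP (phi x); [exists x|exact].
have oB : open B by exact: ball_open.
have oV0 : open V0.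
  rewrite openE => _ [x Bx <-]; apply: filterS (phi_open x 1 Bx ltr01) => z.
  by move=> [y [By _ <-]]; exists y.
have Cphi : Cinfty B phi.
  move=> k.
  have CN : Ck k B (fun x => -1 * l x).
    by apply: CkM => //; [exact: Ck_cst|exact: Ck_linear].
  have Cfl := CkD oB (Ck_subset bU (Cf k)) CN.
  have Cid : Ck k B (idfun : 'rV[R]_N -> 'rV[R]_N).
    by apply: Ck_linear => x; exact: cvg_id.
  apply: Ck_ext (CkD oB Cid (Ck_scale_cst 'e_i oB Cfl)) => // x Bx.
  by rewrite /phi /set_coord /shear -[- rcoord i x]mulN1r.
have psic z : V0 z -> {for z, continuous psi}.
  move=> [x Bx <-] A; rewrite psiK// => /nbhs_ballP[d d0 dA].
  apply: filterS (phi_open x d Bx d0) => _ [y [By bxy <-]].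
  by rewrite /= psiK//; exact: dA.
have psiB : psi @` V0 `<=` B by move=> _ [z /psiP[Bz _] <-].
have dpsi z : V0 z -> is_diff z psi
    (fun v => v + ((l v - 'd f (psi z) v) / 'd f (psi z) 'e_i) *: 'e_i).
  move=> V0z; have [Bz _] := psiP _ V0z.
  apply: is_diff_shear_inverse => //; first exact: bdf.
  - by rewrite -deriveE ?gt_eqF//; [exact: bdf0|exact: bdf].
  - exact: psic.
  - by apply: filterS (open_nbhs_nbhs (conj oV0 V0z)) => y /psiP[].
have Cpsi : Cinfty V0 psi.
  elim=> [|k IHk]; first exact: psic.
  split=> [z /dpsi[]//|v].
  have CD w : Ck k V0 ('D_w f \o psi).
    apply: (Ck_comp_scalar oV0 psiB IHk).
    by apply: Ck_subset bU _; apply: (Cf k.+1).2.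
  have CDV : Ck k V0 (fun z => (('D_('e_i) f \o psi) z)^-1).
    by apply: CkV => // z /psiP[Bz _]; rewrite gt_eqF//; exact: bdf0.
  have CN : Ck k V0 (fun z => l v + -1 * ('D_v f \o psi) z).
    by apply: CkD => //; [exact: Ck_cst|apply: CkM => //; exact: Ck_cst].
  have := CkD oV0 (Ck_cst k V0 v) (Ck_scale_cst 'e_i oV0 (CkM oV0 CN CDV)).
  apply: Ck_ext => // z V0z; have [dpsiz dpsizE] := dpsi _ V0z.
  have dfz := bdf _ (psiB _ (imageP psi V0z)).
  by rewrite deriveE// dpsizE -!deriveE// -[- 'D_v f _]mulN1r.
exists B, V0, psi; split=> //; last exact: ballxx.
split=> //; split=> //.
by move=> z V0z; have [] := psiP z V0z.
Qed.

End Diffeo.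
(** * Submanifolds cut out by two equations *)

Section Codim2.
Context {R : realType} {m : nat}.
Local Notation E := 'rV[R]_(m + 2).

Lemma normalize_derive {N : nat} (f : 'rV[R]_N -> R) U p v : open U -> U p ->
  Cinfty U f -> 'D_v f p != 0 ->
  exists a, [/\ a != 0, Cinfty U (fun x => a * f x) &
    0 < 'D_v (fun x => a * f x) p].
Proof.
move=> oU Up Cf d0; exists ('D_v f p); split=> //.
  by move=> k; apply: CkM => //; exact: Ck_cst.
have dfp : differentiable f p by exact: (Cf 1%N).1.
rewrite (deriveZ _ (diff_derivable dfp)).
by rewrite -[_ *: _]/(_ * _) -expr2 lt_neqAle sqr_ge0 eq_sym sqrf_eq0 d0.
Qed.

Lemma perm_to_last (i k : 'I_(m + 2)) : i != k ->
  exists s : 'S_(m + 2), s (rshift m ord0) = i /\ s (rshift m ord_max) = k.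
Proof.
move=> ik; pose u : 'I_(m + 2) := rshift m ord0.
pose w : 'I_(m + 2) := rshift m ord_max.
have uw : u != w by rewrite -val_eqE /= addn0 addn1 neq_ltn ltnSn.
exists (tperm u i * tperm (tperm u i w) k)%g; rewrite !permM tpermL; split.
  apply: tpermD; last by rewrite eq_sym.
  by rewrite -[X in _ != X](tpermL u i) (inj_eq perm_inj) eq_sym.
exact: tpermL.
Qed.

(** The Jacobian of [(f, g)] in the coordinates [(i, k)] is triangular because
    [g] is invariant along ['e_i].  So replacing [x_i] by [f] leaves [g]
    unchanged, and the second step, replacing [x_k] by [g], starts from [g]
    itself rather than from its composite with the inverse of the first step. *)
Lemma submanifold_two_equations (M : set E) :
  (forall p, M p -> exists (Uf Ug : set E) (f g : E -> R) (i k : 'I_(m + 2)),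
    [/\ [/\ open Uf, Uf p & Cinfty Uf f],
        [/\ open Ug, Ug p & Cinfty Ug g],
        'D_('e_i) f p != 0 /\ 'D_('e_k) g p != 0,
        i != k /\ (forall x a, (Ug (x + a *: 'e_i) <-> Ug x) /\
                               g (x + a *: 'e_i) = g x) &
        forall x, Uf x -> Ug x -> (M x <-> f x = 0 /\ g x = 0)]) ->
  smooth_submanifold m M.
Proof.
move=> chart; split=> [|p Mp]; first exact: leq_addr.
have [Uf [Ug [f0 [g0 [i [k]]]]]] := chart p Mp.
move=> [[oUf Ufp Cf0] [oUg Ugp Cg0] [df0 dg0] [ik inv0] Mfg0].
have [a [a0 Cf df]] := normalize_derive oUf Ufp Cf0 df0.
have [b [b0 Cg dg]] := normalize_derive oUg Ugp Cg0 dg0.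
set f := (fun x => a * f0 x) in Cf df; set g := (fun x => b * g0 x) in Cg dg.
have invU x c : Ug (x + c *: 'e_i) <-> Ug x := (inv0 x c).1.
have invg x c : g (x + c *: 'e_i) = g x by rewrite /g (inv0 x c).2.
have Mfg x : Uf x -> Ug x -> M x <-> f x = 0 /\ g x = 0.
  move=> Ux Ux'; rewrite Mfg0// /f /g.
  split=> [[-> ->]|[/eqP + /eqP]]; first by rewrite !mulr0.
  by rewrite !mulf_eq0 (negbTE a0) (negbTE b0) => /eqP -> /eqP ->.
(* from here on [f] and [g] have positive derivatives *)
clearbody f g; clear a a0 b b0 Cf0 Cg0 df0 dg0 inv0 Mfg0.
have [U1 [V1 [psi1 [D1 U1p U1f]]]] := smooth_diffeo_set_coord oUf Ufp Cf df.
pose q := set_coord i f p.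
have Ugq : Ug q by apply/invU.
have dgq : 0 < 'D_('e_k) g q.
  (* [q] and [p] differ by a multiple of ['e_i] *)
  suff -> : 'D_('e_k) g q = 'D_('e_k) g p by [].
  rewrite /derive /q /set_coord /shear /=.
  by under eq_fun do rewrite addrA !invg.
have [U2 [V2 [psi2 [D2 U2q U2g]]]] := smooth_diffeo_set_coord oUg Ugq Cg dgq.
have [s [si sk]] := perm_to_last ik.
have D12 := smooth_diffeo_comp D1 D2.
have := smooth_diffeo_comp D12 (smooth_diffeo_col_perm s).
set U := _ `&` _; set V := _ `&` _; set phi := _ \o _; set psi := _ \o _.
move=> [oU oV [Cphi phiV phiK] [Cpsi psiU psiK]].
have UU x : U x -> Uf x /\ Ug x.
  move=> [[U1x U2x] _]; split; first exact: U1f.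
  by apply/invU; exact: U2g U2x.
have phii x : rcoord (rshift m ord0) (phi x) = f x.
  rewrite /phi /= /rcoord mxE si -/(rcoord _ _) rcoord_set_coord (negbTE ik).
  by rewrite rcoord_set_coord eqxx.
have phik x : rcoord (rshift m ord_max) (phi x) = g x.
  rewrite /phi /= /rcoord mxE sk -/(rcoord _ _) rcoord_set_coord eqxx.
  exact: invg.
exists U, V, phi, psi; split; first by split.
split=> //; split=> //.
apply/seteqP; split=> [_ [x [Mx Ux] <-]|y [y0 Vy]].
  have [fx gx] := (Mfg x (UU x Ux).1 (UU x Ux).2).1 Mx.
  split; last by apply: phiV; exists x.
  move=> j mj; have [c ->] : exists c : 'I_2, j = rshift m c.
    have jm : (j - m < 2)%N by rewrite ltn_subLR.
    by exists (Ordinal jm); apply/val_inj; rewrite /= subnKC.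
  have [->|->] : c = ord0 \/ c = ord_max.
  - by case: c => -[|[|]]// ?; [left|right]; apply/val_inj.
  - by rewrite -[LHS]/(rcoord _ _) phii.
  - by rewrite -[LHS]/(rcoord _ _) phik.
have Ux : U (psi y) by apply: psiU; exists y.
exists (psi y); last exact: psiK.
split=> //; apply/(Mfg _ (UU _ Ux).1 (UU _ Ux).2).
rewrite -phii -phik psiK//; split; rewrite /rcoord y0//=.
  exact: leq_addr.
exact: leq_addr.
Qed.

End Codim2.
(** * The coordinates (x, t, y) and the fiber function *)

Section Coordinates.
Context {R : realType} {n m : nat} (nm : (n <= m)%N).
Local Notation E := 'rV[R]_(m + 2).

Definition x_index (i : 'I_n) : 'I_(m + 2) :=
  cast_ord (dim_eq nm) (lshift (m - n + 1) (lshift 1 i)).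
Definition t_index : 'I_(m + 2) :=
  cast_ord (dim_eq nm) (lshift (m - n + 1) (rshift n ord0)).
Definition y_index (j : 'I_(m - n + 1)) : 'I_(m + 2) :=
  cast_ord (dim_eq nm) (rshift (n + 1) j).

Definition xt_part (q : E) : 'rV[R]_n * R :=
  (\row_i q ord0 (x_index i), q ord0 t_index).
Definition y_part (q : E) : 'rV[R]_(m - n + 1) := \row_j q ord0 (y_index j).

Lemma join_coordsK (x : 'rV[R]_n) t y :
  xt_part (join_coords nm x t y) = (x, t) /\
  y_part (join_coords nm x t y) = y.
Proof.
split; first congr (_, _).
- apply/rowP => i; rewrite !mxE castmxE /= cast_ord_id /x_index cast_ordK.
  by rewrite !row_mxEl.
- by rewrite castmxE /= cast_ord_id /t_index cast_ordK row_mxEl row_mxEr mxE.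
- apply/rowP => i; rewrite !mxE castmxE /= cast_ord_id /y_index cast_ordK.
  by rewrite row_mxEr.
Qed.

Lemma join_parts (q : E) :
  join_coords nm (xt_part q).1 (xt_part q).2 (y_part q) = q.
Proof.
apply/rowP => k; rewrite castmxE /= cast_ord_id.
rewrite -[k in RHS](cast_ordKV (dim_eq nm)); set k' := cast_ord _ k.
case: (split_ordP k') => [c ->|j ->]; last by rewrite row_mxEr mxE.
rewrite row_mxEl; case: (split_ordP c) => [i ->|i ->].
  by rewrite row_mxEl mxE.
by rewrite row_mxEr mxE (ord1 i).
Qed.

Lemma X_FE (I : base_interval R) (F : 'rV[R]_n * R -> R) (q : E) :
  X_F nm I F q <-> [/\ itv_carrier I (xt_part q).2, F (xt_part q) = 0 &
    fiber_eq I (xt_part q).2 (y_part q) = 0].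
Proof.
split=> [[x [t [y [It Fxt Gty ->]]]]|[It Fxt Gty]].
  by have [-> ->] := join_coordsK x t y.
exists (xt_part q).1, (xt_part q).2, (y_part q).
by rewrite join_parts -surjective_pairing.
Qed.

Lemma xt_part_is_linear : linear xt_part.
Proof.
move=> a u v; rewrite /xt_part !mxE; congr (_, _).
by apply/rowP => i; rewrite !mxE.
Qed.
HB.instance Definition _ :=
  GRing.isLinear.Build R E ('rV[R]_n * R)%type *:%R xt_part xt_part_is_linear.

Lemma xt_part_continuous : continuous xt_part.
Proof.
suff xc : continuous (fun q : E => \row_i q ord0 (x_index i)).
  by move=> q; exact: (cvg_pair (xc q) (@rcoord_continuous R _ t_index q)).
have -> : (fun q : E => \row_i q ord0 (x_index i)) = fun q =>
    \sum_i rcoord (x_index i) q *: 'e_i.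
  apply/funext => z; rewrite [LHS]row_sum_delta; apply: eq_bigr => i _.
  by rewrite mxE.
move=> q; apply: (@Ck_continuous _ _ _ 0 setT) => //.
apply: Ck_sum => [|i]; first exact: openT.
apply: Ck_scale_cst; first exact: openT.
by apply: Ck_linear; exact: rcoord_continuous.
Qed.

Lemma x_t_index_neq i : x_index i != t_index.
Proof. by rewrite -val_eqE /= addn0 neq_ltn ltn_ord. Qed.

Lemma y_t_index_neq j : y_index j != t_index.
Proof. by rewrite -val_eqE /= addn0 addn1 neq_ltn addSn ltnS leq_addr orbT. Qed.

Lemma x_y_index_neq i j : x_index i != y_index j.
Proof. by rewrite -val_eqE /= neq_ltn -addnA ltn_addr. Qed.

Lemma y_index_inj : injective y_index.
Proof. by move=> i j /cast_ord_inj/rshift_inj. Qed.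

Lemma x_index_inj : injective x_index.
Proof. by move=> i j /cast_ord_inj/lshift_inj/lshift_inj. Qed.

Lemma xt_part_x i : xt_part 'e_(x_index i) = ('e_i, 0).
Proof.
rewrite /xt_part mxE eqxx /= eq_sym (negbTE (x_t_index_neq i)).
by congr (_, _); apply/rowP => j; rewrite !mxE /= (inj_eq x_index_inj).
Qed.

Lemma xt_part_t : xt_part 'e_t_index = (0, 1).
Proof.
rewrite /xt_part mxE !eqxx; congr (_, _); apply/rowP => i; rewrite !mxE.
by rewrite (negbTE (x_t_index_neq i)).
Qed.

Lemma xt_part_y j : xt_part 'e_(y_index j) = 0.
Proof.
rewrite /xt_part mxE eqxx /= eq_sym (negbTE (y_t_index_neq j)).
congr (_, _); apply/rowP => i; rewrite !mxE /=.
by rewrite (negbTE (x_y_index_neq i j)).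
Qed.

Lemma xt_part_y_line q j a : xt_part (q + a *: 'e_(y_index j)) = xt_part q.
Proof. by rewrite addrC xt_part_is_linear xt_part_y scaler0 add0r. Qed.

Definition fiber_fun (I : base_interval R) (q : E) : R :=
  fiber_eq I (xt_part q).2 (y_part q).

Lemma fiber_funE I : fiber_fun I =
  match I with
  | Segment a1 a2 =>
      (rcoord t_index - cst a1) * (cst a2 - rcoord t_index)
  | HalfLine a => rcoord t_index - cst a
  end - \sum_j rcoord (y_index j) ^+ 2.
Proof.
apply/funext => q; rewrite /fiber_fun.
have sumE : \sum_j y_part q ord0 j ^+ 2 =
    (\sum_j (rcoord (y_index j) : E -> R) ^+ 2) q.
  by rewrite fct_sumE; apply: eq_bigr => j _; rewrite mxE.
by case: I => [a1 a2|a]; rewrite /fiber_eq sumE.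
Qed.

Lemma fiber_fun_smooth I : Cinfty setT (fiber_fun I).
Proof.
move=> k; rewrite fiber_funE.
have Cr i : Ck k setT (rcoord i : E -> R).
  by apply: Ck_linear; exact: rcoord_continuous.
have CB (f g : E -> R) : Ck k setT f -> Ck k setT g -> Ck k setT (f - g).
  move=> Cf Cg; have CN := CkM openT (Ck_cst k setT (-1 : R)) Cg.
  apply: Ck_ext openT _ (CkD openT Cf CN) => q _.
  by rewrite -[RHS]/(f q - g q) -[- g q]mulN1r.
apply: (CB _ _ _ _).
  case: I => [a1 a2|a]; last by apply: (CB _ _ _ _) => //; exact: Ck_cst.
  by apply: CkM; [exact: openT| |]; apply: (CB _ _ _ _) => //; exact: Ck_cst.
have Csq j := CkM openT (Cr (y_index j)) (Cr (y_index j)).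
apply: (Ck_ext openT) (Ck_sum openT Csq).
by move=> q _; rewrite fct_sumE; apply: eq_bigr => j _.
Qed.

Lemma derive_fiber_fun I q v : 'D_v (fiber_fun I) q =
  match I with
  | Segment a1 a2 => (a1 + a2 - 2 * rcoord t_index q) * rcoord t_index v
  | HalfLine a => rcoord t_index v
  end - \sum_j 2 * rcoord (y_index j) q * rcoord (y_index j) v.
Proof.
have dr i : is_derive q v (rcoord i : E -> R) (rcoord i v).
  have rc := @rcoord_continuous R _ i.
  have dd : differentiable (rcoord i : E -> R) q.
    exact: linear_differentiable.
  apply: DeriveDef; first exact: diff_derivable.
  by rewrite deriveE// diff_lin.
rewrite fiber_funE; case: I => [a1 a2|a]; rewrite derive_val; congr (_ - _).
- rewrite -[LHS]/((rcoord t_index q - a1) * (0 - rcoord t_index v) +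
    (a2 - rcoord t_index q) * (rcoord t_index v - 0)).
  by ring.
- by rewrite subr0.
Qed.

(** This frees the equations of [X_F] from the constraint on [t], so that they
    make sense on an open set. *)
Lemma fiber_fun_itv I q : itv_wf I -> fiber_fun I q = 0 ->
  itv_carrier I (xt_part q).2.
Proof.
rewrite /fiber_fun; move: (xt_part q).2 (y_part q) => t y.
have := @sumr_ge0 R _ (index_enum _) xpredT (fun j => y ord0 j ^+ 2)
  (fun j _ => sqr_ge0 _).
case: I => [a1 a2|a] /=; move: (\sum_j _) => Y Y0.
  move=> a12 /subr0_eq tY; have : 0 <= (t - a1) * (a2 - t) by rewrite tY.
  have [|ta1] := leP a1 t; have [|ta2] := leP t a2 => //.
  - by move=> a1t; nra.
  - by move=> ta; nra.
  - by move=> ?; lra.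
by move=> _ /subr0_eq tY; rewrite -subr_ge0 tY.
Qed.

Lemma fiber_fun_x I q i a :
  fiber_fun I (q + a *: 'e_(x_index i)) = fiber_fun I q.
Proof.
rewrite /fiber_fun; congr fiber_eq.
  by rewrite [LHS]rcoordE eq_sym (negbTE (x_t_index_neq i)) mulr0 addr0.
apply/rowP => j; rewrite !mxE eqxx /= eq_sym (negbTE (x_y_index_neq i j)).
by rewrite mulr0 addr0.
Qed.

Lemma derive_fiber_fun_y I q j :
  'D_('e_(y_index j)) (fiber_fun I) q = - (2 * rcoord (y_index j) q).
Proof.
rewrite derive_fiber_fun.
have -> : rcoord t_index 'e_(y_index j) = 0 :> R.
  by rewrite /rcoord mxE eqxx /= eq_sym (negbTE (y_t_index_neq j)).
have -> : \sum_i 2 * rcoord (y_index i) q * rcoord (y_index i) 'e_(y_index j) =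
    2 * rcoord (y_index j) q.
  rewrite (bigD1 j)//= big1 => [|i ij]; rewrite [X in _ * X]mxE.
    by rewrite !eqxx mulr1 addr0.
  by rewrite eqxx /= (inj_eq y_index_inj) (negbTE ij) mulr0.
by case: I => [a1 a2|a]; rewrite ?mulr0 sub0r.
Qed.

(** At [y = 0] the equation forces [t] to be an endpoint, where the derivative
    is [a2 - a1], [a1 - a2] or [1]. *)
Lemma derive_fiber_fun_t I q : y_part q = 0 -> itv_wf I -> fiber_fun I q = 0 ->
  'D_('e_t_index) (fiber_fun I) q != 0.
Proof.
move=> y0 Iwf; rewrite derive_fiber_fun.
have yj j : rcoord (y_index j) q = 0.
  by have := congr1 (fun y : 'rV_(_) => y ord0 j) y0; rewrite !mxE.
rewrite big1 ?subr0 => [|j _]; last by rewrite yj mulr0 mul0r.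
have -> : rcoord t_index 'e_t_index = 1 :> R by rewrite /rcoord mxE !eqxx.
rewrite /fiber_fun y0 /fiber_eq.
case: I Iwf => [a1 a2|a] /= => [a12|_ _]; last exact: oner_neq0.
rewrite big1 => [|j _]; last by rewrite mxE expr0n.
rewrite subr0 mulr1 /rcoord => /eqP; rewrite mulf_eq0 !subr_eq0.
by move=> /orP[] /eqP h; apply/eqP => h'; move: h h'; lra.
Qed.

Lemma fiber_fun0_endpoint I q : y_part q = 0 -> fiber_fun I q = 0 ->
  match I with
  | Segment a1 a2 => (xt_part q).2 = a1 \/ (xt_part q).2 = a2
  | HalfLine a => (xt_part q).2 = a
  end.
Proof.
rewrite /fiber_fun /fiber_eq => ->.
rewrite big1 => [|j _]; last by rewrite mxE expr0n.
case: I => [a1 a2|a]; rewrite subr0; last by move=> /subr0_eq.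
by move/eqP; rewrite mulf_eq0 !subr_eq0 => /orP[]/eqP; [left|right].
Qed.

End Coordinates.

(** * The hypotheses on F in terms of a smooth extension *)

Section Family.
Context {R : realType} {n : nat}.
Implicit Types (F : 'rV[R]_n * R -> R) (I : base_interval R).

(** Every point of the interval is one of its limit points, so one-sided
    derivatives are genuine limits. *)
Lemma itv_within_proper I t : itv_wf I -> itv_carrier I t ->
  ProperFilter (within (itv_carrier I `\ t) (nbhs t)).
Proof.
move=> Iwf It; apply: Build_ProperFilter_ex => A /nbhs_ballP[e /= e0 tA].
suff [s [Is st ste]] : exists s, [/\ itv_carrier I s, s <> t & ball t e s].
  by exists s; exact: tA.
rewrite -ball_normE /=.
case: I Iwf It {tA} => [a1 a2|a] /= => [a12 /andP[t1 t2]|_ at_]; last first.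
  exists (t + e / 2); split; [by lra|by lra|].
  by rewrite opprD addrA subrr sub0r normrN gtr0_norm; lra.
have [ta2|ta2] := ltP t a2.
  exists (Num.min (t + e / 2) a2).
  have [h|h] := leP (t + e / 2) a2; split; try lra.
  - by rewrite ltr_norml; lra.
  - by rewrite ltr_norml; lra.
exists (Num.max (t - e / 2) a1).
have [h|h] := leP (t - e / 2) a1; split; try lra.
- by rewrite ltr_norml; lra.
- by rewrite ltr_norml; lra.
Qed.

Lemma partial_tE I F F' x t : itv_wf I -> itv_carrier I t ->
  (forall s, itv_carrier I s -> F (x, s) = F' (x, s)) ->
  differentiable F' (x, t) ->
  partial_t I F x t = 'D_((0, 1) : 'rV[R]_n * R) F' (x, t).
Proof.
move=> Iwf It FF' dF'; have := itv_within_proper Iwf It => FF.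
rewrite /partial_t; set quot := fun s => _.
suff : quot s @[s --> within (itv_carrier I `\ t) (nbhs t)] -->
    'D_((0, 1) : 'rV[R]_n * R) F' (x, t) by move/cvg_lim; exact.
apply/cvgrPdist_le => e e0; rewrite /quot {quot}.
have xsc : (x, s) @[s --> t] --> (x, t).
  exact: (cvg_pair (@cvg_cst _ x _ (nbhs t) _) (@cvg_id _ (nbhs t))).
rewrite near_withinE.
have := xsc _ (diff_remainder dF' e0) => near_rem.
apply: (@filterS _ (nbhs t) _ _ _ _ near_rem) => s /= rem [Is st].
have st0 : s - t != 0 by rewrite subr_eq0; apply/eqP.
have ste : (x, s) - (x, t) = (s - t) *: ((0, 1) : 'rV[R]_n * R).
  rewrite -[LHS]/(x - x, s - t) -[RHS]/((s - t) *: 0, (s - t) *: 1).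
  by rewrite subrr scaler0 [_ *: 1]mulr1.
have norm01 : `|((0, 1) : 'rV[R]_n * R)| = 1.
  by rewrite prod_normE /= normr0 normr1 max_r.
rewrite !FF'//; move: rem; rewrite ste linearZ normrZ norm01 mulr1 -deriveE//.
set a := F' (x, s) - _; set b := 'D_ _ _ _.
have -> : b - a / (s - t) = - ((a - (s - t) *: b) / (s - t)).
  by rewrite -[_ *: b]/(_ * b); field.
rewrite normrN normrM normfV => rem; rewrite ler_pdivrMr ?normr_gt0//.
Qed.

(** The differential of the slice is the restriction of that of [F'] to the
    directions [(v, 0)]; if it vanished on the basis vectors, [x] would be
    critical. *)
Lemma slice_regular F F' x t : differentiable F' (x, t) ->
  (forall y, F (y, t) = F' (y, t)) -> ~ critical_point (slice F t) x ->
  exists i, 'D_(('e_i, 0) : 'rV[R]_n * R) F' (x, t) != 0.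
Proof.
move=> dF' FF' crit; apply: contrapT => D0; apply: crit => v.
have -> : slice F t = F' \o (fun y => (y, t)).
  by apply/funext => y; exact: FF'.
have dpair : differentiable (fun y : 'rV[R]_n => (y, t)) x.
  by apply: differentiable_pair => //; exact: differentiable_cst.
rewrite -deriveE; last exact: differentiable_comp.
have -> : 'D_v (F' \o (fun y => (y, t))) x =
    'D_((v, 0) : 'rV[R]_n * R) F' (x, t).
  rewrite /derive /=.
  by under [in RHS]eq_fun do
    rewrite -[X in F' X]/(_ *: v + x, _ *: 0 + t) scaler0 add0r.
rewrite deriveE//.
rewrite [v]row_sum_delta.
have -> : (\sum_i v ord0 i *: 'e_i, 0) =
    \sum_i v ord0 i *: (('e_i, 0) : 'rV[R]_n * R).
  rewrite (big_morph (fun u => (u, 0) : 'rV[R]_n * R)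
    (id1 := 0) (op1 := +%R))// => [|u w]; last first.
    by rewrite -[RHS]/(u + w, 0 + 0) addr0.
  apply: eq_bigr => i _.
  by rewrite -[RHS]/(v ord0 i *: 'e_i, v ord0 i *: 0) scaler0.
rewrite linear_sum big1// => i _; rewrite linearZ -deriveE//.
have [->|d0] := eqVneq ('D_(('e_i, 0) : 'rV[R]_n * R) F' (x, t)) 0.
  exact: scaler0.
by case: D0; exists i.
Qed.

End Family.
(** * The theorem *)

Theorem theorem2 (R : realType) (n m : nat) (n_ge1 : (1 <= n)%N)
  (nm : (n <= m)%N)
  (D : set 'rV[R]_n) (J : finType) (S : J -> set 'rV[R]_n)
  (g : J -> 'rV[R]_n -> R)
  (I : base_interval R) (F : 'rV[R]_n * R -> R)
  (D_open : open D)
  (boundary_D : closure D `\` D = \bigcup_j S j)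
  (S_disj : forall i j, i <> j -> S i `&` S j = set0)
  (S_mfd : forall j, smooth_submanifold (n - 1) (S j))
  (g_smooth : forall j, Cinfty setT (g j))
  (S_comp : forall j, finite_union_of_components (zero_set (g j)) (S j))
  (g_reg : forall j x, S j x -> ~ critical_point (g j) x)
  (I_wf : itv_wf I)
  (F_smooth : smooth_on (setT `*` itv_carrier I) F)
  (closure_D : closure D = [set x | exists2 t, itv_carrier I t & F (x, t) = 0])
  (levels_disj : forall t1 t2, itv_carrier I t1 -> itv_carrier I t2 ->
     t1 <> t2 -> zero_set (slice F t1) `&` zero_set (slice F t2) = set0)
  (ends : endpoint_condition I F S)
  (dFdt : forall x t, itv_carrier I t -> partial_t I F x t <> 0) :
  smooth_submanifold m (X_F nm I F).
Proof.
apply: submanifold_two_equations => p /X_FE[It Fp Gp].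
have [U' [F' [oU' IU' CF' FF']]] := F_smooth.
pose xt := @xt_part R n m nm; pose f := F' \o xt; pose Uf := xt @^-1` U'.
have oUf : open Uf.
  by apply: open_comp => // q _; exact: xt_part_continuous.
have Ufp : Uf p by apply: IU'; split.
have Cf : Cinfty Uf f.
  by move=> k; apply: Ck_comp_linear (CF' k); exact: xt_part_continuous.
have dF' : differentiable F' (xt p) by exact: (CF' 1%N).1.
have FF'I x t : itv_carrier I t -> F (x, t) = F' (x, t).
  by move=> It'; apply: FF'; split.
have XE q : Uf q -> X_F nm I F q <-> f q = 0 /\ fiber_fun nm I q = 0.
  move=> Uq; rewrite X_FE; split=> [[Iq Fq Gq]|[fq Gq]].
    by split=> //; rewrite /f /= -FF'//; split.
  have Iq := fiber_fun_itv I_wf Gq; split=> //.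
  by rewrite FF'//; split.
have df v : 'D_v f p = 'D_(xt v) F' (xt p) by exact: derive_comp_linear.
have dft : 'D_('e_(t_index nm)) f p != 0.
  rewrite df /xt xt_part_t; apply/eqP.
  move: dF'; rewrite /xt [xt_part nm p]surjective_pairing => dF'.
  rewrite -(partial_tE I_wf It (FF'I _) dF').
  exact: dFdt.
(* which triangular Jacobian is available depends on whether [y = 0] *)
have [y0|/existsNP[j yj]] := pselect (forall j, y_part nm p ord0 j = 0).
  have {y0} y0 : y_part nm p = 0 by apply/rowP => j; rewrite y0 mxE.
  have [i dfi] : exists i, 'D_('e_(x_index nm i)) f p != 0.
    have zp : zero_set (slice F (xt p).2) (xt p).1.
      rewrite -[zero_set _ _]/(F ((xt p).1, (xt p).2) = 0).
      by rewrite -surjective_pairing.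
    have reg : ~ critical_point (slice F (xt p).2) (xt p).1.
      have := fiber_fun0_endpoint y0 Gp; rewrite -/xt.
      case: (I) ends => [a1 a2 [_ [r1 r2]] [h|h]|a [_ r] h];
        move: zp; rewrite h.
      - exact: r1.
      - exact: r2.
      - exact: r.
    move: dF'; rewrite [xt p]surjective_pairing => dF'.
    have [i Di] := slice_regular dF' (fun y => FF'I y _ It) reg.
    by exists i; rewrite df /xt xt_part_x -/xt [xt p]surjective_pairing.
  exists Uf, setT, f, (fiber_fun nm I), (x_index nm i), (t_index nm).
  split=> //.
  - by split=> //; [exact: openT|exact: fiber_fun_smooth].
  - by split=> //; exact: derive_fiber_fun_t.
  - split; first exact: x_t_index_neq.
    move=> q a; split=> //.
    exact: fiber_fun_x.
  - by move=> q Uq _; exact: XE.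
exists setT, Uf, (fiber_fun nm I), f, (y_index nm j), (t_index nm).
split=> //.
- by split=> //; [exact: openT|exact: fiber_fun_smooth].
- split=> //; rewrite derive_fiber_fun_y oppr_eq0 mulf_neq0//.
  by apply/eqP => h; apply: yj; rewrite mxE.
- split; first exact: y_t_index_neq.
  move=> q a; have xtq : xt (q + a *: 'e_(y_index nm j)) = xt q.
    exact: xt_part_y_line.
  by rewrite /Uf /f /= xtq.
- by move=> q _ Uq; rewrite XE//; split=> -[].
Qed.
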